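(* For every countable set $A\subset\mathbb{R}$ and every mapping $g$ from $A$ into $]0,\infty[$ there exists a strictly increasing function $f:\mathbb{R}\to\mathbb{R}$ such that $f'(x)=g(x)$ for every $x\in A$ and $f'(x)=0$ for almost all $x\in\mathbb{R}$.
   Context: ''Almost all'' is with respect to Lebesgue measure. The assertion $f'(x)=c$ (with $c$ a real number) means that $f$ is differentiable at $x$ with derivative $c$. $]0,\infty[$ denotes the set of positive real numbers. *)

(* Defs.v *)
From mathcomp Require Import all_boot all_order all_algebra.
From mathcomp Require Import all_classical all_reals all_analysis.

(* Main.v *)
Require Import Defs.
From mathcomp Require Import all_boot all_order all_algebra.
From mathcomp Require Import all_classical all_reals all_analysis.
From mathcomp Require Import ring lra.

Import Order.TTheory GRing.Theory Num.Theory.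
Import numFieldNormedType.Exports.

Local Open Scope classical_set_scope.
Local Open Scope ring_scope.

(** The function need not be continuous: it is a sum of countably many step
    functions, one for each point where a derivative is prescribed.

    Adding the rationals to [A], with prescribed derivative 1 there, makes the
    set of prescribed points dense; enumerate it injectively as [a 0, a 1, ...].
    It then suffices to find a nondecreasing [f] with the right derivatives,
    since positive derivatives on a dense set forbid intervals of constancy
    ([homo_lt_of_dense_derive]).

    The building block [exists_bump] is a rescaled bounded staircase centred at
    [a n] whose steps shrink quadratically towards the centre.  It has the
    prescribed derivative at its centre, is locally constant away from the
    centre and its jumps, and its jumps can be kept off any countable set,
    here the set of all the [a m].  By making it small and narrow, its
    increments from any point [x] at distance at least [r n] from [a n] are
    bounded by [2 ^- n.+1 * (y - x) ^+ 2].

    Let [f] be the sum of these staircases.  If [x] is at distance at least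
    [r n] from [a n] for all large [n], the tail of the series has a quadratic
    increment at [x], hence derivative 0 there, so that [f] is differentiable
    term by term at [x] ([is_derive_series]).  The radii [r n] are chosen with
    two properties in mind:
    - [r n <= `|a m - a n|] for [m < n], so that this applies at every [a m],
      where only the staircase centred at [a m] contributes to the derivative;
    - [r n <= 2 ^- n.+1], so that by Borel-Cantelli it applies at almost every
      [x] ([negligible_often_near]); outside the countable set of centres and
      jumps all the terms have derivative 0. *)

(** * Two criteria for differentiability *)

Lemma is_derive_of_quadratic_bound {R : realType} (f : R -> R) (x c K : R) :
  (forall y, `|f y - f x - c * (y - x)| <= K * (y - x) ^+ 2) ->
  is_derive x (1 : R) f c.
Proof.
move=> fK.
have K0 : 0 <= K.
  by have := le_trans (normr_ge0 _) (fK (x + 1)); rewrite addrAC subrr add0r expr1n mulr1.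
have cvc : (fun h : R => h^-1 *: ((f \o shift x) (h *: (1 : R)) - f x)) @ 0^' --> c.
  apply/cvgrPdist_le => e e0; near=> h.
  have h0 : h != 0 by near: h; exact: nbhs_dnbhs_neq.
  have := fK (h + x); rewrite addrK => fh.
  rewrite /= scaler1 distrC.
  have -> : h^-1 *: (f (h + x) - f x) - c = h^-1 * (f (h + x) - f x - c * h).
    by rewrite /GRing.scale /= [in RHS]mulrBr (mulrC c) mulKf.
  rewrite normrM normfV ler_pdivrMl ?normr_gt0//; apply: (le_trans fh).
  rewrite -real_normK ?num_real// expr2 mulrA mulrC ler_wpM2l//.
  apply: (@le_trans _ _ ((K + 1) * `|h|)); first by rewrite ler_wpM2r// lerDl.
  rewrite mulrC -ler_pdivlMr ?ltr_wpDl//.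
  near: h; apply: dnbhs0_le; rewrite divr_gt0// ltr_wpDl//.
apply: DeriveDef; first by apply/cvg_ex; exists c.
exact: cvg_lim cvc.
Unshelve. all: by end_near. Qed.

Lemma is_derive_locally_constant {R : realType} (f : R -> R) (x : R) :
  (\forall y \near x, f y = f x) -> is_derive x (1 : R) f 0.
Proof.
move=> fx; apply: (@near_eq_is_derive _ _ _ (cst (f x))).
  by apply: filterS fx => y ->.
Qed.

(** * The staircase *)

(** For [t > 0] this is the largest number smaller than [t] among the inverses
    of the positive integers; the relative error of this approximation of [t]
    vanishes as [t] tends to 0. *)
Definition half_stair {R : realType} (t : R) : R :=
  if 0 < t then (Num.floor t^-1 + 1)%:~R^-1 else 0.

Lemma half_stair_le0 {R : realType} (t : R) : t <= 0 -> half_stair t = 0.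
Proof. by rewrite /half_stair leNgt; case: ifP. Qed.

Lemma floor_inv_gt0 {R : realType} (t : R) : 0 < t ->
  0 < (Num.floor t^-1 + 1)%:~R :> R.
Proof.
move=> t0; apply: lt_trans (_ : t^-1 < _); first by rewrite invr_gt0.
by case/andP: (floor_itv t^-1).
Qed.

(** The denominator of [half_stair t] lies between [t^-1] and [t^-1 + 1]. *)
Lemma half_stair_itv {R : realType} (t : R) : 0 < t ->
  t / (1 + t) <= half_stair t <= t.
Proof.
move=> t0; rewrite /half_stair t0; have F0 := floor_inv_gt0 t t0.
have /andP[f1 f2] := floor_itv t^-1.
apply/andP; split; last by rewrite invf_ple ?posrE// ltW.
have -> : t / (1 + t) = (t^-1 + 1)^-1 by field; rewrite ?lt0r_neq0//=; lra.
rewrite lef_pV2 ?posrE// ?intrD ?lerD2r//.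
by rewrite addr_gt0// invr_gt0.
Qed.

Lemma half_stair_ge0 {R : realType} (t : R) : 0 <= half_stair t.
Proof.
have [t0|t0] := leP t 0; first by rewrite half_stair_le0.
have /andP[+ _] := half_stair_itv t t0; apply: le_trans.
by rewrite divr_ge0//; lra.
Qed.

Lemma half_stair_quadratic {R : realType} (t : R) : 0 <= t ->
  `|half_stair t - t| <= t ^+ 2.
Proof.
rewrite le_eqVlt => /predU1P[<-|t0].
  by rewrite half_stair_le0// subrr normr0.
have /andP[h1 h2] := half_stair_itv t t0.
rewrite ler0_norm ?subr_le0// opprB.
have : t - t / (1 + t) <= t ^+ 2.
  have -> : t - t / (1 + t) = t ^+ 2 / (1 + t) by field; lra.
  by rewrite ler_pdivrMr; nra.
lra.
Qed.

Lemma half_stair_mono {R : realType} : {homo @half_stair R : x y / x <= y}.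
Proof.
move=> x y xy; have [x0|x0] := leP x 0.
  by rewrite half_stair_le0// half_stair_ge0.
have y0 : 0 < y by exact: lt_le_trans xy.
rewrite /half_stair x0 y0 lef_pV2 ?posrE ?floor_inv_gt0//.
by rewrite ler_int lerD2r; apply: le_floor; rewrite lef_pV2.
Qed.

Lemma half_stair_gt1 {R : realType} (t : R) : 1 < t -> half_stair t = 1.
Proof.
move=> t1; have t0 : 0 < t by lra.
rewrite /half_stair t0.
have -> : Num.floor t^-1 = 0.
  apply: floor_def; rewrite add0r; apply/andP; split.
    by rewrite invr_ge0 ltW.
  by rewrite invf_lt1.
by rewrite add0r invr1.
Qed.

Lemma half_stair_le1 {R : realType} (t : R) : half_stair t <= 1.
Proof.
rewrite -(half_stair_gt1 (Num.max t 0 + 2)).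
  by apply: half_stair_mono; have := le_max t t 0; rewrite lexx /=; lra.
by have := le_max 0 t 0; rewrite lexx orbT; lra.
Qed.

(** The case [m = 0] of the hypothesis says that [t] is not 0, since the
    inverse of 0 is 0; the other cases say that [t] is not a jump. *)
Lemma half_stair_near {R : realType} (t : R) :
  (forall m : int, t <> m%:~R^-1) ->
  \forall y \near t, half_stair y = half_stair t.
Proof.
move=> tm; have [t0|t0|t0] := ltgtP t 0.
- near=> y; have y0 : y < 0 by near: y; exact: lt_nbhsl.
  by rewrite !half_stair_le0// ltW.
- have /andP[f1 f2] := floor_itv t^-1.
  have {}f1 : (Num.floor t^-1)%:~R < t^-1.
    rewrite lt_neqAle f1 andbT; apply/eqP => e.
    by apply: (tm (Num.floor t^-1)); rewrite e invrK.
  have tV : y^-1 @[y --> t] --> t^-1 by apply: cvgV; rewrite ?lt0r_neq0.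
  near=> y.
  have y0 : 0 < y by near: y; exact: lt_nbhsr.
  rewrite /half_stair t0 y0.
  suff -> : Num.floor y^-1 = Num.floor t^-1 by [].
  apply: floor_def; apply/andP; split.
    by apply: ltW; near: y; apply: (cvgr_gt _ tV).
  by near: y; apply: (cvgr_lt _ tV).
- by have := tm 0; rewrite invr0 t0.
Unshelve. all: by end_near. Qed.

(** The odd extension of [half_stair]; only one of the two terms is nonzero at
    any given point. *)
Definition stair {R : realType} (t : R) : R := half_stair t - half_stair (- t).

Lemma stair_mono {R : realType} : {homo @stair R : x y / x <= y}.
Proof.
by move=> x y xy; apply: lerB; apply: half_stair_mono; rewrite ?lerN2.
Qed.

Lemma stair_norm_le1 {R : realType} (t : R) : `|stair t| <= 1.
Proof.
rewrite ler_norml /stair.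
have [h0 h1] := (half_stair_ge0 t, half_stair_le1 t).
have [g0 g1] := (half_stair_ge0 (- t), half_stair_le1 (- t)).
by apply/andP; split; lra.
Qed.

(** This makes [stair] differentiable at 0 with derivative 1. *)
Lemma stair_quadratic {R : realType} (t : R) : `|stair t - t| <= t ^+ 2.
Proof.
rewrite /stair; have [t0|/ltW t0] := leP 0 t.
  rewrite [half_stair (- t)]half_stair_le0 ?oppr_le0// subr0.
  exact: half_stair_quadratic.
rewrite half_stair_le0// sub0r -opprD normrN -{2}(opprK t) -sqrrN.
by apply: half_stair_quadratic; rewrite oppr_ge0.
Qed.

Lemma stair_gt1 {R : realType} (t : R) : 1 < t -> stair t = 1.
Proof.
by move=> t1; rewrite /stair half_stair_gt1// half_stair_le0 ?subr0//; lra.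
Qed.

Lemma stair_ltN1 {R : realType} (t : R) : t < -1 -> stair t = -1.
Proof.
move=> t1; rewrite /stair [X in _ - X]half_stair_gt1; last lra.
by rewrite half_stair_le0 ?sub0r//; lra.
Qed.

Lemma stair_near {R : realType} (t : R) :
  (forall m : int, t <> m%:~R^-1) ->
  \forall y \near t, stair y = stair t.
Proof.
move=> tm.
have tN (m : int) : - t <> m%:~R^-1.
  by move=> e; apply: (tm (- m)); rewrite rmorphN /= invrN -e opprK.
have hN : \forall y \near t, half_stair (- y) = half_stair (- t).
  have Nc : - y @[y --> t] --> - t by exact: cvgN.
  exact: (Nc _ (half_stair_near (- t) tN)).
have h := half_stair_near t tm.
by near=> y; rewrite /stair; congr (_ - _); near: y.
Unshelve. all: by end_near. Qed.

(** * Staircases with prescribed slope *)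

Lemma countable_avoid {R : realType} (C : set R) (b : R) :
  countable C -> 0 < b -> exists e : R, [/\ 0 < e, e <= b & ~ C e].
Proof.
move=> cC b0; apply: contrapT => noe.
have subC : `]0, b[ `<=` C.
  move=> x /=; rewrite in_itv /= => /andP[x0 xb].
  by apply: contrapT => nCx; apply: noe; exists x; split => //; exact: ltW.
have cI : countable (`]0, b[ : set R) by exact: sub_countable (subset_card_le subC) cC.
have := countable_lebesgue_measure0 cI.
by rewrite lebesgue_measure_itv /= lte_fin b0 oppr0 adde0 => -[] /eqP; rewrite gt_eqF.
Qed.

(** The function is [p.1], and [p.2] collects its centre [a] and its jumps.
    The scale [e] of the staircase is chosen outside a countable set, so that
    no jump falls on a point of [C]; it is small enough for the last bound,
    where either [y] is on the same side of [a] as [x] and both lie beyond the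
    extreme steps, or [`|y - x|] is at least [r / 2] and the total variation
    [2 * (c * e)] is at most [d] times its square. *)
Lemma exists_bump {R : realType} (C : set R) (a c r d : R) :
    countable C -> 0 < c -> 0 < r -> 0 < d ->
  exists p : (R -> R) * set R,
    [/\ {homo p.1 : x y / x <= y}, forall x, `|p.1 x| <= d &
        is_derive a (1 : R) p.1 c] /\
    [/\ countable p.2, forall x, C x -> p.2 x -> x = a,
        forall x, ~ p.2 x -> is_derive x (1 : R) p.1 0 &
        forall x y, r <= `|x - a| -> `|p.1 y - p.1 x| <= d * (y - x) ^+ 2].
Proof.
move=> cC c0 r0 d0.
pose b := Num.min (r / 2) (Num.min (d / c) (d * r ^+ 2 / (8 * c))).
have b0 : 0 < b.
  by rewrite !lt_min !divr_gt0// ?mulr_gt0// exprn_gt0.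
(* a staircase of scale e with a jump at x, other than a, has e = m * (x - a) *)
pose D := \bigcup_(m in [set: int]) [set m%:~R * (x - a) | x in C].
have cD : countable D.
  apply: bigcup_countable => // m _.
  exact: sub_countable (card_image_le _ _) cC.
have [e [e0 eb eD]] := @countable_avoid R D b cD b0.
move: eb; rewrite !le_min => /and3P[er ed edr].
have {}ed : c * e <= d by rewrite mulrC -ler_pdivlMr.
have {}edr : 2 * (c * e) <= d * (r / 2) ^+ 2.
  move: edr; rewrite ler_pdivlMr ?mulr_gt0//; lra.
have c1 : 0 < c * e by rewrite mulr_gt0.
pose phi x := c * e * stair ((x - a) / e).
(* m = 0 gives the centre a, because 0^-1 = 0 *)
pose E := [set a + e / m%:~R | m in [set: int]].
exists (phi, E); split; split => /=.
- move=> x y xy; apply: ler_wpM2l; first exact: ltW.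
  by apply: stair_mono; rewrite ler_pM2r ?invr_gt0// lerD2r.
- move=> x; rewrite normrM (gtr0_norm c1); apply: le_trans ed.
  by rewrite ger_pMr// stair_norm_le1.
- apply: (@is_derive_of_quadratic_bound _ _ _ _ (c / e)) => y.
  have -> : phi a = 0.
    by rewrite /phi subrr mul0r /stair oppr0 subrr mulr0.
  rewrite subr0 /phi; set t := (y - a) / e.
  have -> : y - a = e * t by rewrite /t mulrC divfK// lt0r_neq0.
  rewrite mulrA -mulrBr normrM (gtr0_norm c1).
  have -> : c / e * (e * t) ^+ 2 = c * e * t ^+ 2 by field; exact: lt0r_neq0.
  by rewrite ler_pM2l// stair_quadratic.
- exact: sub_countable (card_image_le _ _) _.
- move=> x Cx [m _ xE]; have [m0|m0] := eqVneq m 0.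
    by rewrite -xE m0 invr0 mulr0 addr0.
  exfalso; apply: eD; exists m => //; exists x => //.
  by rewrite -xE addrAC subrr add0r mulrC divfK// intr_eq0.
- move=> x nEx; apply: is_derive_locally_constant.
  have tm (m : int) : (x - a) / e <> m%:~R^-1.
    move=> xm; apply: nEx; exists m => //.
    by rewrite -xm mulrC divfK ?lt0r_neq0// addrC subrK.
  have cvt : (y - a) / e @[y --> x] --> (x - a) / e.
    by apply: cvgMr_tmp; apply: cvgB => //; exact: cvg_cst.
  near=> y; rewrite /phi; congr (_ * _); near: y.
  exact: (cvt _ (stair_near _ tm)).
- move=> x y rx.
  have [xy|xy] := leP (r / 2) `|y - x|.
    apply: (@le_trans _ _ (2 * (c * e))); last first.
      apply: (le_trans edr); rewrite ler_pM2l// -[leRHS]real_normK ?num_real//.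
      by rewrite lerXn2r ?nnegrE// divr_ge0// ltW.
    rewrite -mulrBr normrM (gtr0_norm c1) mulrC ler_pM2r//.
    apply: (le_trans (ler_normB _ _)).
    by have := (lerD (stair_norm_le1 ((y - a) / e)) (stair_norm_le1 ((x - a) / e))).
  suff -> : phi y = phi x by rewrite subrr normr0 mulr_ge0// ?sqr_ge0// ltW.
  rewrite /phi; congr (_ * _).
  move: xy; rewrite ltr_norml => /andP[xy1 xy2].
  move: rx; rewrite ler_normr => /orP[] rx.
    by rewrite !stair_gt1// ltr_pdivlMr// mul1r; lra.
  by rewrite !stair_ltN1// ltr_pdivrMr// mulN1r; lra.
Unshelve. all: by end_near. Qed.

(** * Termwise differentiation and monotonicity *)

(** The increments at [x] of the remainder after [N] terms are at most the sum
    of [v] times the square of [y - x], so the remainder has derivative 0. *)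
Lemma is_derive_series {R : realType} (phi : nat -> R -> R) (v d : nat -> R)
    (N : nat) (x : R) :
    cvgn (series v) -> (forall n y, `|phi n y| <= v n) ->
    (forall n, (n < N)%N -> is_derive x (1 : R) (phi n) (d n)) ->
    (forall n y, (N <= n)%N -> `|phi n y - phi n x| <= v n * (y - x) ^+ 2) ->
  is_derive x (1 : R) (fun y => limn (series (phi^~ y))) (\sum_(n < N) d n).
Proof.
move=> cv phiv dphi tail.
have v0 n : 0 <= v n by exact: le_trans (normr_ge0 _) (phiv n x).
have cphi y : cvgn (series (phi^~ y)).
  by exact/normed_cvg/(series_le_cvg (fun n => normr_ge0 (phi n y)) v0 (phiv^~ y) cv).
pose T y := limn (series (phi^~ y)) - (\sum_(n < N) phi n) y.
have -> : (fun y => limn (series (phi^~ y))) = (\sum_(n < N) phi n) + T.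
  by apply/funext => y; rewrite /T /GRing.add /= addrC subrK.
rewrite -[X in is_derive _ _ _ X]addr0; apply: is_deriveD.
  by apply: is_derive_sum => i; exact: dphi.
apply: (@is_derive_of_quadratic_bound _ _ _ _ (limn (series v))) => y.
rewrite mul0r subr0.
have cvT z : series (phi^~ z) n - (\sum_(i < N) phi i) z @[n --> \oo] --> T z.
  by apply: cvgB; [exact: cphi|exact: cvg_cst].
apply: (cvgr_to_le (cvg_norm (cvgB (cvT y) (cvT x)))).
near=> n.
have Nn : (N <= n)%N by near: n; exact: nbhs_infty_ge.
have tailE z : series (phi^~ z) n - (\sum_(i < N) phi i) z =
    \sum_(N <= k < n) phi k z.
  rewrite fct_sumE /series /= (@big_cat_nat _ _ _ N 0 n)//= big_mkord.
  by rewrite addrAC subrr add0r.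
change (`|(series (phi^~ y) n - (\sum_(i < N) phi i) y) -
  (series (phi^~ x) n - (\sum_(i < N) phi i) x)| <= limn (series v) * (y - x) ^+ 2).
rewrite !tailE -sumrB (le_trans (ler_norm_sum _ _ _))//.
apply: (@le_trans _ _ (\sum_(N <= k < n) v k * (y - x) ^+ 2)).
  rewrite big_nat [leRHS]big_nat; apply: ler_sum => k /andP[Nk _].
  exact: tail.
rewrite -mulr_suml ler_wpM2r ?sqr_ge0//.
apply: (@le_trans _ _ (series v n)).
  by rewrite /series /= [leRHS](@big_cat_nat _ _ _ N 0 n)//= lerDr sumr_ge0.
apply: nondecreasing_cvgn_le => //.
by apply: nondecreasing_series => k _ _.
Unshelve. all: by end_near. Qed.

(** If [f x = f y], then [f] is constant on the interval between them, which
    forces the derivative to be 0 at its interior points. *)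
Lemma homo_lt_of_dense_derive {R : realType} (f : R -> R) :
    {homo f : x y / x <= y} ->
    (forall x y : R, x < y -> exists z c : R,
      [/\ x < z < y, 0 < c & is_derive z (1 : R) f c]) ->
  {homo f : x y / x < y}.
Proof.
move=> fmono fD x y xy; rewrite lt_neqAle fmono ?ltW// andbT.
apply/eqP => fxy; have [z [c [/andP[xz zy] c0 fc]]] := fD x y xy.
have fz0 : is_derive z (1 : R) f 0.
  apply: is_derive_locally_constant; near=> w.
  have fE u : x < u -> u < y -> f u = f x.
    by move=> xu uy; apply/eqP; rewrite eq_le [X in _ <= X]fxy !fmono ?ltW.
  by rewrite !fE//; near: w; [exact: lt_nbhsr|exact: lt_nbhsl].
have := @derive_val _ _ _ _ _ _ _ fc; rewrite (@derive_val _ _ _ _ _ _ _ fz0).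
by move=> c00; rewrite -c00 ltxx in c0.
Unshelve. all: by end_near. Qed.

(** * Choice of the centres and radii *)

Lemma exists_separation {R : realType} (a : nat -> R) (n : nat) (d : R) :
    injective a -> 0 < d ->
  exists r : R, [/\ 0 < r, r <= d & forall m, (m < n)%N -> r <= `|a m - a n|].
Proof.
move=> ainj d0; suff [r [r0 rd rn]] : exists r : R, [/\ 0 < r, r <= d &
    forall m, (m < n)%N -> m != n -> r <= `|a m - a n|].
  by exists r; split => // m mn; apply: rn => //; rewrite ltn_eqF.
(* the bound on m is decoupled from the index n to allow an induction *)
elim: {1}n => [|k [r [r0 rd rk]]]; first by exists d.
exists (if k == n then r else Num.min r `|a k - a n|); case: eqVneq => kn; split => //.
- move=> m; rewrite ltnS leq_eqVlt => /predU1P[->|]; first by rewrite kn eqxx.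
  exact: rk.
- by rewrite lt_min r0 normr_gt0 subr_eq0 (inj_eq ainj).
- by rewrite ge_min rd.
- move=> m; rewrite ltnS leq_eqVlt ge_min => /predU1P[->|mk mn].
    by rewrite lexx orbT.
  by rewrite rk.
Qed.

(** Adjoining the rationals makes the set dense and infinite, so that it is in
    bijection with the natural numbers. *)
Lemma enum_dense_countable {R : realType} (A : set R) : countable A ->
  exists a : nat -> R, [/\ injective a, A `<=` range a &
    forall x y : R, x < y -> exists n, x < a n < y].
Proof.
move=> cA; pose Q := [set (ratr q : R) | q in [set: rat]].
have cQ : countable Q by exact: sub_countable (card_image_le _ _) _.
have iQ : infinite_set Q.
  move=> fQ; apply: infinite_nat.
  have -> : [set: nat] = (fun n : nat => n%:R : R) @^-1` Q.
    by rewrite predeqE => n; split=> // _; exists n%:R; rewrite // ratr_nat.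
  apply: finite_preimage fQ => m n _ _ /eqP.
  by rewrite eqr_nat => /eqP.
have /card_esym/pcard_eqP/unsquash a : (A `|` Q #= [set: nat])%card.
  apply: eq_card_nat; first by rewrite -bigcup2E; apply: bigcup_countable => // -[|[|[]]].
  by apply: contra_not iQ; apply: sub_finite_set; exact: subsetUr.
have asurj x : (A `|` Q) x -> exists n, a n = x.
  by move=> /(@surj _ _ _ _ a) [n _ <-]; exists n.
exists a; split.
- by move=> m n; apply: (@inj _ _ _ a); rewrite inE.
- by move=> x Ax; have [|n <-] := asurj x; [left|exists n].
- move=> x y /rat_in_itvoo[q]; rewrite in_itv /= => qxy.
  by have [|n nE] := asurj (ratr q); [right; exists q|exists n; rewrite nE].
Qed.

(** * Negligible sets *)

Lemma negligible_countable {R : realType} (A : set R) :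
  countable A -> (@lebesgue_measure R).-negligible A.
Proof.
by move=> cA; apply/negligible_outer_measure; exact: countable_lebesgue_measure0.
Qed.

(** By Borel-Cantelli, almost every point lies in only finitely many of the
    balls of centre [a n] and radius [r n], whose measures are summable. *)
Lemma negligible_often_near {R : realType} (a r : nat -> R) :
    (forall n, 0 <= r n) -> (forall n, r n <= (2 ^ n.+1)%:R^-1) ->
  (@lebesgue_measure R).-negligible
    [set x | ~ exists N, forall n, (N <= n)%N -> r n <= `|x - a n|].
Proof.
move=> r0 rn; pose F n := ball (a n) (r n).
have mF n : measurable (F n) by exact: measurable_realfun.measurable_ball.
exists (lim_sup_set F); split.
- by apply: bigcapT_measurable => n; apply: bigcup_measurable => k _; exact: mF.
- apply: lim_sup_set_cvg0 => //.
  apply: (@le_lt_trans _ _ (\sum_(0 <= n <oo) (2 / (2 ^ (n + 1))%:R : R)%:E)%E).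
    apply: lee_nneseries => // n _.
    apply: (@le_trans _ _ (r n *+ 2)%:E).
      by rewrite -(lebesgue_measure_ball (a n) (r0 n)).
    by rewrite lee_fin addn1 -[leLHS]mulr_natl ler_wpM2l.
  suff -> : (\sum_(0 <= n <oo) (2 / (2 ^ (n + 1))%:R : R)%:E)%E = (2 / 2 ^+ 0)%:E.
    exact: ltry.
  by apply: cvg_lim => //; exact: cvg_geometric_eseries_half.
- move=> x /= nx N _; apply: contrapT => nF; apply: nx; exists N => n Nn.
  rewrite leNgt; apply/negP => xan; apply: nF; exists n => //.
  by rewrite /F -ball_normE /= distrC.
Qed.

(** * The theorem *)

Theorem mainTheorem2 (R : realType) (A : set R) (cA : countable A)
    (g : R -> R) (g_gt0 : forall x : R, A x -> 0 < g x) :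
  exists f : R -> R,
    [/\ {homo f : x y / x < y},
        forall x : R, A x -> is_derive x (1 : R) f (g x) &
        {ae @lebesgue_measure R, forall x : R, is_derive x (1 : R) f 0}].
Proof.
have [a [ainj Aa adense]] := enum_dense_countable A cA.
pose c x := if x \in A then g x else 1.
have c0 x : 0 < c x.
  by rewrite /c; case: ifPn => // xA; apply: g_gt0; rewrite inE in xA.
pose v n : R := (2 ^ n.+1)%:R^-1.
have v0 n : 0 < v n by rewrite invr_gt0 ltr0n expn_gt0.
have cv : cvgn (series v).
  have -> : v = geometric 2^-1 2^-1.
    by apply/funext => n; rewrite /v /= -exprS natrX exprVn.
  by apply: is_cvg_geometric_series; rewrite ger0_norm ?invf_lt1 ?ltr1n.
have [r rP] := choice (fun n => exists_separation a n (v n) ainj (v0 n)).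
have r0 n : 0 < r n by case: (rP n).
have rv n : r n <= v n by case: (rP n).
have crange : countable (range a) by exact: sub_countable (card_image_le _ _) _.
have [p pP] := choice (fun n =>
  exists_bump (range a) (a n) (c (a n)) (r n) (v n) crange (c0 _) (r0 n) (v0 n)).
pose phi n := (p n).1; pose E n := (p n).2.
have phi_v n y : `|phi n y| <= v n by have [[_ + _] _] := pP n; exact.
pose f y := limn (series (phi^~ y)).
have fmono : {homo f : x y / x <= y}.
  have cphi y : cvgn (series (phi^~ y)).
    exact/normed_cvg/(series_le_cvg (fun n => normr_ge0 (phi n y)) (fun n => ltW (v0 n)) (phi_v^~ y) cv).
  by move=> x y xy; apply: lim_series_le => // n; case: (pP n) => -[+ _ _] _; apply.
(* at a n, the series is differentiated termwise after the first n + 1 terms *)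
have fa n : is_derive (a n) (1 : R) f (c (a n)).
  have -> : c (a n) = \sum_(i < n.+1) (if i == n :> nat then c (a i) else 0).
    rewrite -big_mkcond /= (big_pred1 ord_max)//.
  apply: (@is_derive_series _ _ v (fun i => if i == n then c (a i) else 0)) => //.
    move=> i _; case: (pP i) => -[_ _ phia] [_ EP phiE _].
    case: eqVneq => [<-//|ni]; apply: phiE => Ei.
    by have /ainj/esym/eqP := EP _ (imageT a n) Ei; rewrite (negPf ni).
  move=> i y ni; case: (pP i) => _ [_ _ _ +]; apply.
  rewrite distrC; case: (rP i) => _ _; rewrite distrC; exact.
exists f; split.
- apply: homo_lt_of_dense_derive => // x y /adense[n xany].
  by exists (a n), (c (a n)).
- move=> x Ax; have [n _ anx] := Aa x Ax.
  by have := fa n; rewrite anx /c mem_set.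
- have cE : countable (\bigcup_n E n).
    by apply: bigcup_countable => // n _; case: (pP n) => _ [].
  apply: negligibleS (negligibleU (negligible_countable _ cE)
    (negligible_often_near a r (fun n => ltW (r0 n)) rv)).
  move=> x /= nfx; apply: contrapT => /not_orP[nE /contrapT[N far]]; apply: nfx.
  have -> : 0 = \sum_(i < N) (0 : R) by rewrite big1.
  apply: (@is_derive_series _ _ v (fun=> 0)) => //.
    move=> n _; case: (pP n) => _ [_ _ + _]; apply => En.
    by apply: nE; exists n.
  by move=> n y Nn; case: (pP n) => _ [_ _ _ +]; apply; exact: far.
Qed.
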